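(* Let $\Gamma$ be a finitely generated group with finite generating set $X$, let $S\subset\Gamma\setminus\{1\}$ be a finite set, and let $\delta\in\Gamma\setminus\{1\}$ have the following property: for any homomorphism $\varphi:\Gamma\to Q$ to a group $Q$, if $\ker\varphi\cap S\neq\emptyset$, then $\delta\in\ker\varphi$. Then $\mathrm{lcm}_{\Gamma,X}(S)\le\|\delta\|_X$.
   Context: $\|\cdot\|_X$ denotes word length with respect to $X$. For a finite set $S$ of nontrivial elements of $\Gamma$, let $L_S=\bigcap_{\gamma\in S}\overline{\langle\gamma\rangle}$, where $\overline{\langle\gamma\rangle}$ is the normal closure in $\Gamma$ of the cyclic subgroup generated by $\gamma$. Let $\mathrm{LCM}_{\Gamma,X}(S)$ be the set of nontrivial elements of $L_S$ of minimal word length among nontrivial elements of $L_S$. Define $\mathrm{lcm}_{\Gamma,X}(S)=\|\eta\|_X$ for any $\eta\in\mathrm{LCM}_{\Gamma,X}(S)$ if this set is nonempty, and $\mathrm{lcm}_{\Gamma,X}(S)=0$ if it is empty. *)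

(* Defs.v *)
From HB Require Import structures.
From mathcomp Require Export all_boot.
From mathcomp Require Export all_classical.

Set Implicit Arguments.
Unset Strict Implicit.
Unset Printing Implicit Defensive.

Local Open Scope classical_set_scope.
Local Open Scope group_scope.

Definition subgroup (G : groupType) (H : set G) : Prop := group_closed [in H].

Definition normal_subgroup (G : groupType) (N : set G) : Prop :=
  subgroup N /\ forall x y : G, N x -> N (x ^ y).

Definition generated (G : groupType) (A : set G) : set G := smallest (@subgroup G) A.

Definition normal_closure (G : groupType) (A : set G) : set G :=
  smallest (@normal_subgroup G) A.

Definition kernel (G H : groupType) (phi : {multiplicative G -> H}) : set G :=
  phi @^-1` [set 1].

Definition spelled_in (G : groupType) (X : set G) (x : G) (n : nat) : Prop :=
  exists w : seq G,
    [/\ size w = n, {in w, forall a, X a \/ X a^-1} & \prod_(a <- w) a = x].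

(* The value 0 for an x that is not a word over X is a dummy, never reached
   when X generates G. *)
Definition word_length (G : groupType) (X : set G) (x : G) : nat :=
  if pselect (exists n, `[< spelled_in X x n >]) is left ex then ex_minn ex
  else 0%N.

(* For S = set0 this is the whole group. *)
Definition Lset (G : groupType) (S : set G) : set G :=
  \bigcap_(gamma in S) normal_closure (generated [set gamma]).

Definition LCM (G : groupType) (X S : set G) : set G :=
  [set eta | [/\ Lset S eta, eta <> 1 &
     forall zeta, Lset S zeta -> zeta <> 1 ->
       (word_length X eta <= word_length X zeta)%N]].

(* All elements of LCM X S have the same length, so the choice made by xget
   is immaterial. *)
Definition lcm_length (G : groupType) (X S : set G) : nat :=
  if `[< LCM X S !=set0 >] then word_length X (xget 1 (LCM X S)) else 0%N.

(* Main.v *)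
From HB Require Import structures.
Require Import Defs.
From mathcomp Require Import all_boot all_classical.

Local Open Scope classical_set_scope.
Local Open Scope group_scope.
Local Open Scope quotient_scope.

(** Let gamma be in S and let N be a normal subgroup containing gamma. The
    projection G -> G / N kills gamma, so the hypothesis on delta puts delta in
    N. Hence delta lies in the normal closure of every gamma in S, that is,
    in L_S, and the minimal length over nontrivial elements of L_S is at most
    that of delta. *)

Lemma normal_subgroup_kernel (G : groupType) (N : set G) :
  normal_subgroup N ->
  exists (Q : groupType) (phi : {multiplicative G -> Q}), kernel phi = N.
Proof.
move=> [sN nN].
have N1 : N 1 by move: sN.1; rewrite inE.
have NV x : N x -> N x^-1.
  by move=> /mem_set Nx; apply/set_mem/(group_closedV sN).
have NM x y : N x -> N y -> N (x * y).
  by move=> /mem_set Nx /mem_set Ny; apply/set_mem/(group_closedM sN).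
pose e : rel G := fun x y => `[< N (x / y) >].
have e_refl : reflexive e by move=> x; apply/asboolP; rewrite divgg.
have eW x y : e x y -> e y x.
  by move=> /asboolP /NV; rewrite invgF => /asboolP.
have e_sym : symmetric e by move=> x y; apply/idP/idP; apply: eW.
have e_trans : transitive e.
  move=> y x z /asboolP Nxy /asboolP Nyz; apply/asboolP.
  by have := NM _ _ Nxy Nyz; rewrite mulgA mulgVK.
pose E := EquivRel e e_refl e_sym e_trans.
pose Q := {eq_quot E}.
have piEq x y : \pi_Q x = \pi_Q y <-> N (x / y).
  split=> [/eqP|Nxy]; last by apply/eqP; rewrite eqmodE; apply/asboolP.
  by rewrite eqmodE => /asboolP.
have [mulQ mulQE] : exists mulQ : Q -> Q -> Q,
    forall x y, mulQ (\pi_Q x) (\pi_Q y) = \pi_Q (x * y).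
  exists (fun u v => \pi_Q (repr u * repr v)) => x y.
  have /piEq Nx : \pi_Q (repr (\pi_Q x)) = \pi_Q x by rewrite reprK.
  have /piEq Ny : \pi_Q (repr (\pi_Q y)) = \pi_Q y by rewrite reprK.
  set a := repr _ in Nx *; set b := repr _ in Ny *; apply/piEq.
  have -> : (a * b) / (x * y) = (b / y) ^ a^-1 * (a / x).
    by rewrite conjgE invgK invgM !mulgA mulgVK.
  by apply: NM => //; apply: nN.
have [invQ invQE] : exists invQ : Q -> Q,
    forall x, invQ (\pi_Q x) = \pi_Q x^-1.
  exists (fun u => \pi_Q (repr u)^-1) => x.
  have /esym/piEq Nx : \pi_Q (repr (\pi_Q x)) = \pi_Q x by rewrite reprK.
  set a := repr _ in Nx *; apply/piEq.
  have -> : a^-1 / x^-1 = (x / a) ^ a.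
    by rewrite conjgE invgK -!mulgA mulVg mulg1.
  exact: nN.
have mulQA : associative mulQ.
  move=> u v w; rewrite -[u]reprK -[v]reprK -[w]reprK.
  by rewrite !mulQE mulgA.
have mul1Q : left_id (\pi_Q 1) mulQ.
  by move=> u; rewrite -[u]reprK mulQE mul1g.
have mulQ1 : right_id (\pi_Q 1) mulQ.
  by move=> u; rewrite -[u]reprK mulQE mulg1.
have mulVQ : left_inverse (\pi_Q 1) invQ mulQ.
  by move=> u; rewrite -[u]reprK invQE mulQE mulVg.
have mulQV : right_inverse (\pi_Q 1) invQ mulQ.
  by move=> u; rewrite -[u]reprK invQE mulQE mulgV.
pose isGroupQ := isGroup.Build Q mulQA mul1Q mulQ1 mulVQ mulQV.
pose gQ : groupType := HB.pack Q isGroupQ.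
pose f : G -> gQ := fun x => \pi_Q x.
have fM : {morph f : x y / x * y} by move=> x y; rewrite /f -mulQE.
pose phi : {multiplicative G -> gQ} :=
  HB.pack f (isMultiplicative.Build G gQ f fM).
exists gQ, phi; apply/seteqP; split=> x.
  by move=> /piEq; rewrite divg1.
by move=> Nx; apply/piEq; rewrite divg1.
Qed.

Lemma lcm_length_le (G : groupType) (X S : set G) (eta : G) :
  Lset S eta -> eta <> 1 -> (lcm_length X S <= word_length X eta)%N.
Proof.
move=> Leta eta1; rewrite /lcm_length; case: asboolP => // LCM0.
by have [_ _] := xgetPex 1 LCM0; apply.
Qed.

Theorem lemma3p1 (Gamma : groupType)
    (X : set Gamma) (finX : finite_set X) (genX : generated X = [set: Gamma])
    (S : set Gamma) (finS : finite_set S) (S1 : S `<=` [set~ 1])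
    (delta : Gamma) (delta1 : delta <> 1)
    (Hdelta : forall (Q : groupType) (phi : {multiplicative Gamma -> Q}),
       kernel phi `&` S !=set0 -> kernel phi delta) :
  (lcm_length X S <= word_length X delta)%N.
Proof.
apply: lcm_length_le => // gamma Sgamma N [normN genN].
have [Q [phi kerphi]] := normal_subgroup_kernel _ _ normN.
rewrite -kerphi; apply: Hdelta; exists gamma; split=> //.
by rewrite kerphi; apply: genN; exact: sub_gen_smallest.
Qed.
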